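(* A commutative semigroup variety $\mathcal V$ is a lower-modular element of the lattice $\mathbf{Com}$ of all commutative semigroup varieties if and only if either $\mathcal V=\mathcal{COM}$, or $\mathcal V=\mathcal M\vee\mathcal N$ where $\mathcal M$ is one of the varieties $\mathcal T$ or $\mathcal{SL}$ and $\mathcal N$ is a commutative semigroup variety that is $0$-reduced in $\mathbf{Com}$.
   Context: A semigroup variety is a class of semigroups defined by a set of semigroup identities. $\mathbf{Com}$ is the lattice (under inclusion) of all varieties consisting of commutative semigroups; meet is intersection and $\mathcal M\vee\mathcal N$ is the least variety containing $\mathcal M$ and $\mathcal N$. $\mathcal{COM}$ is the variety of all commutative semigroups, $\mathcal T$ is the trivial variety, and $\mathcal{SL}$ is the variety of all semilattices (semigroups satisfying $xy=yx$ and $x^2=x$). For a word $w$, the symbolic identity $w=0$ abbreviates the pair of identities $wx=xw=w$ where $x$ is a letter not occurring in $w$; identities of the form $w=0$ are called $0$-reduced. A commutative semigroup variety is $0$-reduced in $\mathbf{Com}$ if it is defined within $\mathcal{COM}$ by $0$-reduced identities only. An element $x$ of a lattice $L$ is lower-modular if for all $y,z\in L$ with $x\le y$ one has $x\vee(y\wedge z)=y\wedge(x\vee z)$. *)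

(* Defs.v *)
From HB Require Import structures.
From mathcomp Require Import all_boot all_order.
From mathcomp Require Import boolp classical_sets.

Set Implicit Arguments.
Unset Strict Implicit.
Unset Printing Implicit Defensive.

Import Order.TTheory.

Local Open Scope classical_set_scope.

(* The library's semigroupType is not used: its universe is too large for the *)
(* classes of semigroups to form a latticeType.                               *)
Record semigroup : Type := Semigroup {
  carrier :> Type;
  mul : carrier -> carrier -> carrier;
  mulA : associative mul;
  carrier_nonempty : inhabited carrier
}.

(* Words are elements of the free semigroup over the letters 0, 1, 2, ...;    *)
(* (x, s) stands for the nonempty word x :: s.                                *)
Definition word : Type := (nat * seq nat)%type.

Definition letter (x : nat) : word := (x, [::]).

Definition letters (w : word) : seq nat := w.1 :: w.2.

Definition wcat (u v : word) : word := (u.1, u.2 ++ letters v).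

Definition weval (S : semigroup) (phi : nat -> S) (w : word) : S :=
  foldl (fun a x => mul a (phi x)) (phi w.1) w.2.

Definition identity : Type := (word * word)%type.

Definition satisfies (S : semigroup) (e : identity) : Prop :=
  forall phi : nat -> S, weval phi e.1 = weval phi e.2.

Definition models (E : set identity) : set semigroup :=
  [set S | forall e, E e -> satisfies S e].

Definition is_variety (C : set semigroup) : Prop :=
  exists E : set identity, C = models E.

Definition commutative_identity : identity :=
  (wcat (letter 0) (letter 1), wcat (letter 1) (letter 0)).

Definition idempotent_identity : identity :=
  (wcat (letter 0) (letter 0), letter 0).

Definition trivial_identity : identity := (letter 0, letter 1).

(* The identities wx = w and xw = w abbreviated by w = 0, for every letter x  *)
(* not occurring in w (the choice of x is immaterial).                        *)
Definition zero_identities (w : word) : set identity :=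
  [set e | exists2 x : nat, x \notin letters w &
     e = (wcat w (letter x), w) \/ e = (wcat (letter x) w, w)].

Definition commutative_semigroups : set semigroup :=
  models [set commutative_identity].

Record com_variety : Type := ComVariety {
  variety_class :> set semigroup;
  com_variety_is_variety : is_variety variety_class;
  com_variety_commutative : variety_class `<=` commutative_semigroups
}.

Lemma commutative_semigroupsE (S : semigroup) :
  commutative_semigroups S <-> commutative (@mul S).
Proof.
split=> [comS a b|comS e -> phi]; last exact: comS.
exact: (comS _ erefl (fun n => if n is 0 then a else b)).
Qed.

Lemma weval_wcat (S : semigroup) (phi : nat -> S) (u v : word) :
  weval phi (wcat u v) = mul (weval phi u) (weval phi v).
Proof.
rewrite /weval foldl_cat /=; elim/last_ind: v.2 => [|s x IHs] //.
by rewrite !foldl_rcons IHs mulA.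
Qed.

Lemma models_setU (E F : set identity) :
  models (E `|` F) = models E `&` models F.
Proof.
apply/seteqP; split=> [S mS|S [mE mF] e [Ee|Fe]].
- by split=> e Ee; apply: mS; [left|right].
- exact: mE.
- exact: mF.
Qed.

Lemma is_variety_models (E : set identity) : is_variety (models E).
Proof. by exists E. Qed.

Lemma is_variety_bigcap (F : set (set semigroup)) :
  F `<=` is_variety -> is_variety (\bigcap_(C in F) C).
Proof.
move=> Fvar; exists [set e | exists2 C, F C & forall S, C S -> satisfies S e].
apply/seteqP; split=> [S FS e [C FC Ce]|S mS C FC].
  exact: Ce (FS _ FC).
have [E CE] := Fvar _ FC; rewrite CE => e Ee.
by apply: mS; exists C => // S'; rewrite CE; apply.
Qed.

(* The least variety containing the classes C and D.                          *)
Definition variety_join (C D : set semigroup) : set semigroup :=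
  \bigcap_(X in [set X | is_variety X /\ C `|` D `<=` X]) X.

Section ComLattice.
Implicit Types V W : com_variety.

Lemma com_variety_eq V W : V = W :> set semigroup -> V = W.
Proof.
case: V W => [C vC cC] [D vD cD] /= CD; rewrite CD in vC cC *.
by rewrite (Prop_irrelevance vC vD) (Prop_irrelevance cC cD).
Qed.

Fact meet_is_variety V W : is_variety (V `&` W).
Proof.
have [E ->] := com_variety_is_variety V.
have [F ->] := com_variety_is_variety W.
by exists (E `|` F); rewrite models_setU.
Qed.

Fact meet_commutative V W : V `&` W `<=` commutative_semigroups.
Proof. by move=> S [VS _]; exact: (com_variety_commutative VS). Qed.

Definition com_meet V W : com_variety :=
  ComVariety (@meet_is_variety V W) (@meet_commutative V W).

Fact join_is_variety V W : is_variety (variety_join V W).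
Proof. by apply: is_variety_bigcap => X []. Qed.

Fact join_commutative V W : variety_join V W `<=` commutative_semigroups.
Proof.
move=> S; apply; split; first exact: is_variety_models.
by move=> S' [] /com_variety_commutative.
Qed.

Definition com_join V W : com_variety :=
  ComVariety (@join_is_variety V W) (@join_commutative V W).

HB.instance Definition _ := gen_eqMixin com_variety.
HB.instance Definition _ := gen_choiceMixin com_variety.

Definition com_le V W : bool := `[< V `<=` W >].

Fact com_le_refl : reflexive com_le.
Proof. by move=> V; apply/asboolP. Qed.

Fact com_le_anti : antisymmetric com_le.
Proof.
move=> V W /andP[/asboolP VW /asboolP WV].
by apply: com_variety_eq; apply/seteqP.
Qed.

Fact com_le_trans : transitive com_le.
Proof.
move=> W V X /asboolP VW /asboolP WX.
by apply/asboolP; apply: subset_trans WX.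
Qed.

Fact com_display : Order.disp_t. Proof. exact: Order.Disp tt tt. Qed.

HB.instance Definition _ := @Order.Le_isPOrder.Build com_display com_variety
  com_le com_le_refl com_le_anti com_le_trans.

Lemma com_leE V W : (V <= W)%O <-> V `<=` W.
Proof. by split=> /asboolP. Qed.

Fact com_meetP V W X : (V <= com_meet W X)%O = (V <= W)%O && (V <= X)%O.
Proof.
apply/asboolP/andP => [VWX|[/com_leE VW /com_leE VX] S VS].
  by split; apply/com_leE => S /VWX[].
by split; [exact: VW|exact: VX].
Qed.

Fact com_joinP V W X : (com_join V W <= X)%O = (V <= X)%O && (W <= X)%O.
Proof.
apply/asboolP/andP => [VWX|[/com_leE VX /com_leE WX] S].
  by split; apply/com_leE => S YS; apply: VWX => Y [_]; apply; [left|right].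
apply; split; first exact: com_variety_is_variety.
by move=> S' []; [exact: VX|exact: WX].
Qed.

HB.instance Definition _ :=
  @Order.POrder_MeetJoin_isLattice.Build com_display com_variety
    com_meet com_join com_meetP com_joinP.

End ComLattice.

Definition COM : com_variety :=
  ComVariety (is_variety_models _) (@subset_refl _ commutative_semigroups).

Fact SL_commutative :
  models [set commutative_identity; idempotent_identity]
    `<=` commutative_semigroups.
Proof. by rewrite models_setU => S []. Qed.

Definition SL : com_variety := ComVariety (is_variety_models _) SL_commutative.

Fact TRIV_commutative :
  models [set trivial_identity] `<=` commutative_semigroups.
Proof.
move=> S trivS; apply/commutative_semigroupsE => a b.
exact: (trivS _ erefl (fun n => if n is 0 then mul a b else mul b a)).
Qed.

Definition TRIV : com_variety :=
  ComVariety (is_variety_models _) TRIV_commutative.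

Definition zero_reduced (V : com_variety) : Prop :=
  exists Z : set word,
    V = models ([set commutative_identity] `|`
                \bigcup_(w in Z) zero_identities w) :> set semigroup.

Definition lower_modular (d : Order.disp_t) (L : latticeType d) (x : L) :
    Prop :=
  forall y z : L, (x <= y)%O ->
    Order.join x (Order.meet y z) = Order.meet y (Order.join x z).

(* Main.v *)
Require Import Defs.
From mathcomp Require Import all_boot all_order.
From mathcomp Require Import boolp classical_sets.
From mathcomp Require Import zify.
From Stdlib Require Import Relation_Operators.
Import Order.TTheory.
Import Defs.

Set Implicit Arguments.
Unset Strict Implicit.
Unset Printing Implicit Defensive.

(* Commutative varieties correspond, in reverse order, to the fully invariant *)
(* congruences R on words that contain commutativity, and lower modularity    *)
(* becomes: if S <= R, then R /\ (S \/ T) <= S \/ (R /\ T).                   *)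
(*                                                                            *)
(* If the only nontrivial class of R is an ideal I, a detour outside I in a   *)
(* chain of S- and T-steps consists of T-steps only, so its endpoints are     *)
(* related by R /\ T. If the classes inside I are given by the content, a     *)
(* T-step changing the content makes the word it starts from absorb, modulo   *)
(* T, a power t^m of every t; then the whole chain can be mapped to words     *)
(* with the content of its endpoints and multiplied by such a power.          *)
(*                                                                            *)
(* Conversely, suppose that R relates distinct u, v. Choose S to be the       *)
(* restriction of R to an ideal not containing u, and T relating u and v to   *)
(* R-related words of this ideal: then u is related by R /\ T to another      *)
(* word. Since R is periodic, doing this with u = x^(r-2) y^2 and T generated *)
(* by x^(r-2) y^2 = x^(r-1) y and by equating all words longer than r yields  *)
(* x^(r-2) y^2 = x^(r-1) y in R for large r, hence x^e = x^(e+1) and          *)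
(* x^e y = x^e y^2. Taking next for T the equality of contents and of the     *)
(* numbers of occurrences modulo e, every nontrivial class of R meets the     *)
(* ideal generated by x^e; so the words with a nontrivial class form an ideal *)
(* on which R is either total or equality of contents.                        *)

(** * Words and evaluation *)

(** The theories of [TRIV] and [SL] are [full_rel] and [same_content], a 0-reduced variety has
    theory [restrict I full_rel] for a fully invariant ideal [I] ([zero_reducedP]), empty for [COM],
    and the theory of a join is an intersection. After the translation [lower_modularP], the claim
    is that the upper modular theories are exactly [restrict I full_rel] and
    [restrict I same_content]. That these are upper modular is [restrict_upper_modular]. The
    converse, [upper_modular_restrict], rests on [upper_modular_detour], which forces new identities
    into [R] through a well-chosen [T]. It yields [upper_modular_absorbs] (a word with a high power
    of a letter absorbs its own letters) and [upper_modular_power] (every word in a nontrivial class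
    is related to a word with such a power). What remains is whether [R] preserves contents. *)

Lemma wcatA : associative wcat.
Proof. by move=> [x s] [y t] [z r]; rewrite /wcat /letters /= -catA. Qed.

Definition word_semigroup : semigroup :=
  @Semigroup word wcat wcatA (inhabits (letter 0)).

Definition wsubst (phi : nat -> word) (w : word) : word :=
  @weval word_semigroup phi w.

Lemma letters_wcat (u v : word) : letters (wcat u v) = letters u ++ letters v.
Proof. by []. Qed.

Lemma weval_rcons (S : semigroup) (phi : nat -> S) (x y : nat) (s : seq nat) :
  weval phi (x, rcons s y) = mul (weval phi (x, s)) (phi y).
Proof. by rewrite /weval /= foldl_rcons. Qed.

Lemma wsubst_letter (phi : nat -> word) (x : nat) :
  wsubst phi (letter x) = phi x.
Proof. by []. Qed.

Lemma wsubst_id (w : word) : wsubst letter w = w.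
Proof.
case: w => x s; elim/last_ind: s => [|s y IHs] //.
by rewrite /wsubst weval_rcons -/(wsubst _ _) IHs /wcat -cats1.
Qed.

Lemma wsubst_wcat (phi : nat -> word) (u v : word) :
  wsubst phi (wcat u v) = wcat (wsubst phi u) (wsubst phi v).
Proof. exact: (@weval_wcat word_semigroup). Qed.

Lemma letters_wsubst (phi : nat -> word) (w : word) :
  letters (wsubst phi w) = flatten [seq letters (phi x) | x <- letters w].
Proof.
case: w => x s; elim/last_ind: s => [|s y IHs] /=; first by rewrite cats0.
by rewrite /wsubst weval_rcons letters_wcat IHs /= map_rcons flatten_rcons catA.
Qed.

Lemma weval_wsubst (S : semigroup) (psi : nat -> S) (phi : nat -> word)
    (w : word) :
  weval psi (wsubst phi w) = weval (fun x => weval psi (phi x)) w.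
Proof.
case: w => x s; elim/last_ind: s => [|s y IHs] //.
by rewrite /wsubst !weval_rcons -IHs -weval_wcat.
Qed.

Lemma weval_perm (S : semigroup) (phi : nat -> S) (u v : word) :
  commutative (@mul S) -> perm_eq (letters u) (letters v) ->
  weval phi u = weval phi v.
Proof.
move=> mulC.
(* Adjoining a unit [None] gives a commutative monoid, where big operators are invariant under
   permutation. *)
pose op := oAC (@mulA S) mulC.
have big w : Some (weval phi w) = \big[op/None]_(x <- letters w) Some (phi x).
  case: w => x s; elim/last_ind: s => [|s y IHs].
    by rewrite /letters big_seq1.
  rewrite weval_rcons /letters /= -rcons_cons big_rcons /=.
  by rewrite -[in RHS]/(letters (x, s)) -IHs.
by move=> uv; apply: Some_inj; rewrite !big; exact: perm_big.
Qed.

(** * Equational theories *)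

Definition wrel : Type := word -> word -> Prop.

(** [fic_perm] contains both reflexivity and commutativity, so multiplication on one side suffices
    in [fic_wcat]. *)
Record fi_congruence (R : wrel) : Prop := FICongruence {
  fic_perm : forall u v, perm_eq (letters u) (letters v) -> R u v;
  fic_sym : forall u v, R u v -> R v u;
  fic_trans : forall v u w, R u v -> R v w -> R u w;
  fic_wcat : forall w u v, R u v -> R (wcat u w) (wcat v w);
  fic_subst : forall phi u v, R u v -> R (wsubst phi u) (wsubst phi v)
}.

Lemma fic_wcatC (R : wrel) (u v : word) :
  fi_congruence R -> R (wcat u v) (wcat v u).
Proof. by move=> fR; apply: (fic_perm fR); rewrite !letters_wcat perm_catC. Qed.

Definition identities (R : wrel) : set identity := [set e | R e.1 e.2]%classic.

Definition theory (C : set semigroup) : wrel :=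
  fun u v => forall S, C S -> satisfies S (u, v).

Lemma theory_fic (C : set semigroup) :
  (C `<=` commutative_semigroups)%classic -> fi_congruence (theory C).
Proof.
move=> Ccom; split.
- move=> u v uv S /Ccom/commutative_semigroupsE SC phi; exact: weval_perm.
- by move=> u v uv S CS phi; rewrite uv.
- by move=> v u w uv vw S CS phi; rewrite [LHS]uv // [LHS]vw.
- by move=> w u v uv S CS phi; rewrite /= !weval_wcat uv.
- by move=> phi u v uv S CS psi; rewrite /= !weval_wsubst uv.
Qed.

Lemma theory_models (C : set semigroup) :
  is_variety C -> C = models (identities (theory C)).
Proof.
move=> [E ->]; apply/seteqP; split=> S mS.
  by case=> u v; apply.
by move=> e Ee; apply: (mS e) => S' mS'; apply: mS'; case: e Ee.
Qed.

Section RelativelyFreeSemigroup.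
Variables (R : wrel) (ficR : fi_congruence R).

(* The elements are canonical representatives of the classes, rather than     *)
(* elements of the library's quotient types, whose universe is too large for  *)
(* the carrier of a semigroup.                                                *)
Let norm (u : word) : word := xget (letter 0) (R u).

Let normR (u : word) : R u (norm u).
Proof. by apply: (@xgetI _ _ (R u) u); exact: fic_perm. Qed.

Let norm_eq (u v : word) : R u v <-> norm u = norm v.
Proof.
split=> uv; last first.
  by apply: (fic_trans ficR (normR u)); rewrite uv; exact: fic_sym.
congr xget; apply/funext => w; apply/propext.
split; first exact: fic_trans ficR _ _ _ (fic_sym ficR uv).
exact: fic_trans ficR _ _ _ uv.
Qed.

Let norm_id (u : word) : norm (norm u) == norm u.
Proof. by apply/eqP/norm_eq; exact: fic_sym. Qed.

Let Q : Type := {u : word | norm u == u}.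

Let pi (u : word) : Q := exist _ (norm u) (norm_id u).

Let piP (u v : word) : R u v <-> pi u = pi v.
Proof.
split=> [/norm_eq uv|/(congr1 sval) /norm_eq //].
exact: val_inj.
Qed.

Let reprK (a : Q) : pi (sval a) = a.
Proof. by apply: val_inj; apply/eqP; exact: (svalP a). Qed.

Let reprR (u : word) : R (sval (pi u)) u.
Proof. by apply/piP; rewrite reprK. Qed.

Let qmul (a b : Q) : Q := pi (wcat (sval a) (sval b)).

Let fic_wcat2 (u u' v v' : word) :
  R u u' -> R v v' -> R (wcat u v) (wcat u' v').
Proof.
move=> uu' vv'; apply: (fic_trans ficR (fic_wcat ficR v uu')).
apply: (fic_trans ficR (fic_wcatC _ _ ficR)).
by apply: (fic_trans ficR (fic_wcat ficR u' vv')); exact: fic_wcatC.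
Qed.

Let qmul_pi (u v : word) : qmul (pi u) (pi v) = pi (wcat u v).
Proof. by apply/piP; apply: fic_wcat2; exact: reprR. Qed.

Let qmulA : associative qmul.
Proof.
have mulA u v w : qmul (pi u) (qmul (pi v) (pi w)) =
    qmul (qmul (pi u) (pi v)) (pi w).
  by move: (wcatA u v w); rewrite !qmul_pi => ->.
by move=> a b c; have := mulA (sval a) (sval b) (sval c); rewrite !reprK.
Qed.

Definition free_of : semigroup := Semigroup qmulA (inhabits (pi (letter 0))).

Let weval_free (phi : nat -> word) (w : word) :
  @weval free_of (fun x => pi (phi x)) w = pi (wsubst phi w).
Proof.
case: w => x s; elim/last_ind: s => [|s y IHs] //.
by rewrite weval_rcons IHs /= qmul_pi /wsubst weval_rcons.
Qed.

(** Completeness: evaluating at the classes of the letters recovers [R], and any valuation lifts to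
    a substitution, under which [R] is stable. *)
Lemma free_ofP (u v : word) : satisfies free_of (u, v) <-> R u v.
Proof.
split=> [|uv phi /=].
  move=> /(_ (fun x => pi (letter x))) /=.
  by rewrite !weval_free !wsubst_id => /piP.
have -> : phi = (fun x => pi (sval (phi x))).
  by apply/funext => x; rewrite reprK.
by rewrite !weval_free; apply/piP; exact: fic_subst.
Qed.

End RelativelyFreeSemigroup.

Lemma theory_modelsK (R : wrel) :
  fi_congruence R -> theory (models (identities R)) = R.
Proof.
move=> ficR; apply/funext => u; apply/funext => v; apply/propext; split.
  by move=> uv; apply/(free_ofP ficR)/uv => -[a b] /(free_ofP ficR).
by move=> uv S /(_ (u, v)); apply.
Qed.

(** * Lower modularity in terms of equational theories *)

Definition fic_join (R T : wrel) : wrel :=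
  clos_refl_trans word (fun u v => R u v \/ T u v).

Definition rel_meet (R T : wrel) : wrel := fun u v => R u v /\ T u v.

Definition sub_wrel (R T : wrel) : Prop := forall u v, R u v -> T u v.

Definition upper_modular (R : wrel) : Prop :=
  forall S T, fi_congruence S -> fi_congruence T -> sub_wrel S R ->
  forall u v, R u v -> fic_join S T u v -> fic_join S (rel_meet R T) u v.

Lemma fic_meet (R T : wrel) :
  fi_congruence R -> fi_congruence T -> fi_congruence (rel_meet R T).
Proof.
move=> [pR sR tR wR iR] [pT sT tT wT iT]; split.
- by move=> u v uv; split; [apply: pR|apply: pT].
- by move=> u v [? ?]; split; [apply: sR|apply: sT].
- by move=> v u w [? ?] [? ?]; split; [apply: (tR v)|apply: (tT v)].
- by move=> w u v [? ?]; split; [apply: wR|apply: wT].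
- by move=> phi u v [? ?]; split; [apply: iR|apply: iT].
Qed.

Lemma fic_joinP (R T : wrel) :
  fi_congruence R -> fi_congruence T -> fi_congruence (fic_join R T).
Proof.
move=> [pR sR tR wR iR] [pT sT tT wT iT]; split.
- by move=> u v uv; apply: rt_step; left; apply: pR.
- move=> u v; elim=> [a b [ab|ab]|a|a b c _ ba _ cb].
  + by apply: rt_step; left; apply: sR.
  + by apply: rt_step; right; apply: sT.
  + exact: rt_refl.
  + exact: rt_trans cb ba.
- by move=> v u w; exact: rt_trans.
- move=> w u v; elim=> [a b [ab|ab]|a|a b c _ ab _ bc].
  + by apply: rt_step; left; apply: wR.
  + by apply: rt_step; right; apply: wT.
  + exact: rt_refl.
  + exact: rt_trans ab bc.
- move=> phi u v; elim=> [a b [ab|ab]|a|a b c _ ab _ bc].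
  + by apply: rt_step; left; apply: iR.
  + by apply: rt_step; right; apply: iT.
  + exact: rt_refl.
  + exact: rt_trans ab bc.
Qed.

Lemma fic_joinl (R T : wrel) : sub_wrel R (fic_join R T).
Proof. by move=> u v uv; apply: rt_step; left. Qed.

Lemma fic_joinr (R T : wrel) : sub_wrel T (fic_join R T).
Proof. by move=> u v uv; apply: rt_step; right. Qed.

Lemma fic_join_min (R T X : wrel) :
  fi_congruence X -> sub_wrel R X -> sub_wrel T X -> sub_wrel (fic_join R T) X.
Proof.
move=> fX RX TX u v; elim=> [a b [/RX|/TX]|a|a b c _ ab _ bc] //.
  exact: fic_perm.
exact: fic_trans fX _ _ _ ab bc.
Qed.

Lemma theory_le (V W : com_variety) :
  (V <= W)%O <-> sub_wrel (theory W) (theory V).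
Proof.
split=> [/com_leE VW u v uv S VS|WV]; first exact/uv/VW.
apply/com_leE => S; rewrite (theory_models (com_variety_is_variety V)).
rewrite (theory_models (com_variety_is_variety W)) => mS [u v] uv.
exact/(mS (u, v))/WV.
Qed.

Lemma theory_inj (V W : com_variety) : theory V = theory W -> V = W.
Proof.
by move=> VW; apply/eqP; rewrite eq_le; apply/andP;
  split; apply/theory_le; rewrite VW.
Qed.

Lemma theory_com (V : com_variety) : fi_congruence (theory V).
Proof. by apply: theory_fic; exact: com_variety_commutative. Qed.

Fact com_of_commutative (R : wrel) : fi_congruence R ->
  (models (identities R) `<=` commutative_semigroups)%classic.
Proof.
move=> fR S mS _ ->; apply: mS; apply: (fic_perm fR).
by rewrite !letters_wcat perm_catC.
Qed.

Definition com_of (R : wrel) (fR : fi_congruence R) : com_variety :=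
  ComVariety (is_variety_models (identities R)) (com_of_commutative fR).

Lemma theory_com_of (R : wrel) (fR : fi_congruence R) : theory (com_of fR) = R.
Proof. exact: theory_modelsK. Qed.

(** Theories reverse the order, so the universal property of the join identifies it with the variety
    of the intersection. *)
Lemma theory_join (V W : com_variety) :
  theory (Order.join V W) = rel_meet (theory V) (theory W).
Proof.
have fM := fic_meet (theory_com V) (theory_com W).
have -> : Order.join V W = com_of fM.
  apply/eqP; rewrite eq_le leUx; apply/andP; split; last first.
    apply/theory_le; rewrite theory_com_of => u v uv; split.
      exact: (theory_le _ _).1 (leUl V W) u v uv.
    exact: (theory_le _ _).1 (leUr W V) u v uv.
  by apply/andP; split; apply/theory_le; rewrite theory_com_of => u v [].
exact: theory_com_of.
Qed.

Lemma theory_meet (V W : com_variety) :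
  theory (Order.meet V W) = fic_join (theory V) (theory W).
Proof.
have fJ := fic_joinP (theory_com V) (theory_com W).
have -> : Order.meet V W = com_of fJ.
  apply/eqP; rewrite eq_le lexI; apply/andP; split.
    apply/theory_le; rewrite theory_com_of.
    apply: fic_join_min; first exact: theory_com.
      by apply/theory_le; exact: leIl.
    by apply/theory_le; exact: leIr.
  apply/andP; split; apply/theory_le; rewrite theory_com_of.
    exact: fic_joinl.
  exact: fic_joinr.
exact: theory_com_of.
Qed.

Lemma lower_modularP (V : com_variety) :
  lower_modular V <-> upper_modular (theory V).
Proof.
split=> [lmV S T fS fT SV u v Vuv STuv|umV Y Z VY].
  have VY : (V <= com_of fS)%O by apply/theory_le; rewrite theory_com_of.
  have := congr1 (fun W : com_variety => theory W) (lmV _ (com_of fT) VY).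
  rewrite theory_join !theory_meet theory_join !theory_com_of => E.
  have : rel_meet (theory V) (fic_join S T) u v by [].
  by rewrite E.
have YV := (theory_le V Y).1 VY.
have [fV fY fZ] := And3 (theory_com V) (theory_com Y) (theory_com Z).
apply: theory_inj; rewrite theory_join !theory_meet theory_join.
apply/funext => u; apply/funext => v; apply/propext; split=> [[]|].
  exact: umV.
move: u v; apply: fic_join_min.
- by apply: fic_meet => //; exact: fic_joinP.
- by move=> u v uv; split; [exact: YV|exact: fic_joinl].
- by move=> u v [uv uv']; split; last exact: fic_joinr.
Qed.

(** * Ideals and 0-reduced varieties *)

Lemma fic_refl (R : wrel) (u : word) : fi_congruence R -> R u u.
Proof. by move=> fR; exact: fic_perm. Qed.

(** Rewriting inside a word up to the order of letters. The context [s] may be empty, which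
    [fic_wcat] does not allow because words are nonempty. *)
Lemma fic_ext (R : wrel) (s : seq nat) (a b u v : word) :
  fi_congruence R -> R a b ->
  perm_eq (letters u) (letters a ++ s) ->
  perm_eq (letters v) (letters b ++ s) ->
  R u v.
Proof.
move=> fR ab; case: s => [|x s] ua vb; last first.
  apply: (fic_trans fR (v := wcat a (x, s))); first exact: fic_perm.
  apply: (fic_trans fR (fic_wcat fR (x, s) ab)).
  by apply: fic_perm => //; rewrite perm_sym.
rewrite !cats0 in ua vb.
apply: (fic_trans fR (fic_perm fR ua)); apply: (fic_trans fR ab).
by apply: fic_perm => //; rewrite perm_sym.
Qed.

Lemma eq_weval (S : semigroup) (phi psi : nat -> S) (w : word) :
  {in letters w, phi =1 psi} -> weval phi w = weval psi w.
Proof.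
case: w => x s; elim/last_ind: s => [|s y IHs] eq_phi.
  by apply: eq_phi; rewrite mem_head.
rewrite !weval_rcons eq_phi ?IHs // => [z zs|].
  apply: eq_phi; move: zs.
  by rewrite /letters /= !inE mem_rcons inE => /orP[->//|->]; rewrite !orbT.
by rewrite /letters /= inE mem_rcons mem_head orbT.
Qed.

Lemma fresh_letter (w : word) : exists x, x \notin letters w.
Proof.
exists (\max_(y <- letters w) y).+1.
apply/negP => maxw.
by have := @leq_bigmax_seq _ (letters w) xpredT id _ maxw isT; rewrite ltnn.
Qed.

Lemma weval_fresh (S : semigroup) (phi : nat -> S) (x : nat) (a : S)
    (w : word) :
  x \notin letters w ->
  weval (fun y => if y == x then a else phi y) w = weval phi w.
Proof.
by move=> xw; apply: eq_weval => y yw; case: eqP => // yx; rewrite -yx yw in xw.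
Qed.

Lemma wsubst_fresh (phi : nat -> word) (x : nat) (v w : word) :
  x \notin letters w ->
  wsubst (fun y => if y == x then v else phi y) w = wsubst phi w.
Proof. exact: (@weval_fresh word_semigroup). Qed.

Record fi_ideal (I : word -> Prop) : Prop := FIIdeal {
  fi_perm : forall u v, perm_eq (letters u) (letters v) -> I u -> I v;
  fi_wcat : forall w u, I u -> I (wcat u w);
  fi_subst : forall phi u, I u -> I (wsubst phi u)
}.

(** For [full_rel] this is the Rees congruence of [I] on the free commutative semigroup. *)
Definition restrict (I : word -> Prop) (R : wrel) : wrel :=
  fun u v => perm_eq (letters u) (letters v) \/ [/\ I u, I v & R u v].

Definition full_rel : wrel := fun _ _ => True.

Definition same_content : wrel := fun u v => letters u =i letters v.

Lemma count_wsubst (P : pred nat) (phi : nat -> word) (w : word) :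
  count P (letters (wsubst phi w)) =
  sumn [seq count P (letters (phi x)) | x <- letters w].
Proof. by rewrite letters_wsubst count_flatten -map_comp. Qed.

Lemma mem_wsubst (y : nat) (phi : nat -> word) (w : word) :
  reflect (exists2 x, x \in letters w & y \in letters (phi x))
    (y \in letters (wsubst phi w)).
Proof. by rewrite letters_wsubst; exact: flatten_mapP. Qed.

Lemma perm_wsubst (phi : nat -> word) (u v : word) :
  perm_eq (letters u) (letters v) ->
  perm_eq (letters (wsubst phi u)) (letters (wsubst phi v)).
Proof. by move=> uv; rewrite !letters_wsubst; apply/perm_flatten/perm_map. Qed.

Lemma fic_full : fi_congruence full_rel.
Proof. by []. Qed.

Lemma fic_content : fi_congruence same_content.
Proof.
split=> [u v /perm_mem //|u v uv x|v u w uv vw x|w u v uv x|phi u v uv x].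
- by rewrite uv.
- by rewrite uv.
- by rewrite !letters_wcat !mem_cat uv.
- by apply/mem_wsubst/mem_wsubst => -[y yw xy]; exists y; rewrite ?uv // -uv.
Qed.

Lemma fic_restrict (I : word -> Prop) (R : wrel) :
  fi_ideal I -> fi_congruence R -> fi_congruence (restrict I R).
Proof.
move=> [pI wI iI] fR; split.
- by left.
- move=> u v [uv|[Iu Iv uv]]; [by left; rewrite perm_sym|].
  by right; split=> //; exact: fic_sym.
- move=> v u w [uv|[Iu Iv uv]] [vw|[Iv' Iw vw]].
  + by left; exact: perm_trans vw.
  + right; split=> //; first by apply: pI Iv'; rewrite perm_sym.
    exact: fic_trans fR _ _ _ (fic_perm fR uv) vw.
  + right; split=> //; first exact: pI vw Iv.
    exact: fic_trans fR _ _ _ uv (fic_perm fR vw).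
  + by right; split=> //; exact: fic_trans fR _ _ _ uv vw.
- move=> w u v [uv|[Iu Iv uv]]; first by left; rewrite !letters_wcat perm_cat2r.
  by right; split; [exact: wI|exact: wI|exact: fic_wcat].
- move=> phi u v [uv|[Iu Iv uv]]; first by left; exact: perm_wsubst.
  by right; split; [exact: iI|exact: iI|exact: fic_subst].
Qed.

Lemma fic_absorb (R : wrel) (u v : word) :
  fi_congruence R ->
  (forall y, y \in letters v -> R u (wcat u (letter y))) -> R u (wcat u v).
Proof.
move=> fR; case: v => x s; elim/last_ind: s => [|s y IHs] absv.
  by apply: absv; rewrite mem_head.
have {}IHs : R u (wcat u (x, s)).
  apply: IHs => z zs; apply: absv; move: zs.
  by rewrite /letters /= !inE mem_rcons inE => /orP[->//|->]; rewrite !orbT.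
apply: (fic_trans fR (absv y _)).
  by rewrite /letters /= !inE mem_rcons mem_head orbT.
apply: (fic_ext (s := [:: y]) fR IHs) => //.
by rewrite /wcat /letters /= -cats1 -catA.
Qed.

Lemma theory_TRIV : theory TRIV = full_rel.
Proof.
apply/funext => u; apply/funext => v; apply/propext; split=> // _ S trivS phi.
exact: (trivS _ erefl
  (fun n => if n is 0 then weval phi u else weval phi v)).
Qed.

Lemma theory_SL : theory SL = same_content.
Proof.
have fS := theory_com SL.
apply/funext => u; apply/funext => v; apply/propext; split=> uv; last first.
  (* Both words are then equal to their product. *)
  suff abs a b : same_content a b -> theory SL a (wcat a b).
    apply: (fic_trans fS (abs _ _ uv)).
    apply: (fic_trans fS (v := wcat v u)).
      exact: fic_wcatC.
    by apply: (fic_sym fS); apply: abs; exact: (fic_sym fic_content).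
  move=> ab; apply: fic_absorb => // y; rewrite -ab => ya.
  have idem : theory SL (letter y) (wcat (letter y) (letter y)).
    by move=> S mS phi; symmetry; exact: (mS _ (or_intror erefl) (fun=> phi y)).
  apply: (fic_ext (s := rem y (letters a)) fS idem); first exact: perm_to_rem.
  by rewrite letters_wcat perm_catC /= perm_cons perm_to_rem.
(* The relatively free semigroup of [same_content] is a semilattice, hence satisfies every identity
   of [SL]. *)
apply/(free_ofP fic_content); apply: uv => e [] ->;
  by apply/(free_ofP fic_content) => x; rewrite /= !inE ?orbb // orbC.
Qed.

(** The ideal consists of the words that are a zero modulo the theory. Two such words are both equal
    to their product, and substituting for the fresh letter turns [w = 0] into absorption of any
    word. *)
Lemma zero_reducedP (N : com_variety) :
  zero_reduced N <-> exists2 I, fi_ideal I & theory N = restrict I full_rel.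
Proof.
split=> [[Z NE]|[I fI NI]]; last first.
  exists [set w | I w]%classic.
  rewrite (theory_models (com_variety_is_variety N)) NI models_setU.
  apply/seteqP; split=> [S mS|S [mS zS] [u v] /= [uv|[Iu Iv _]]].
  - split=> [_ ->|e [w Iw [x xw ewx]]].
      by apply: mS; left; rewrite /= !letters_wcat perm_catC.
    apply: mS; case: ewx => -> /=; right; split=> //; first exact: fi_wcat.
    by apply: (fi_perm fI) (fi_wcat fI (letter x) Iw);
      rewrite !letters_wcat perm_catC.
  - move=> phi; apply: weval_perm => //; exact/commutative_semigroupsE.
  have abs w (phi : nat -> S) a : I w -> mul (weval phi w) a = weval phi w.
    move=> Iw; have [x xw] := fresh_letter w.
    pose psi y := if y == x then a else phi y.
    have /(_ psi) :=
      zS _ (ex_intro2 _ _ w Iw (ex_intro2 _ _ x xw (or_introl erefl))).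
    by rewrite /= weval_wcat weval_fresh // /weval /= /psi eqxx.
  move=> phi /=; rewrite -(abs u phi (weval phi v)) //.
  rewrite -[RHS](abs v phi (weval phi u)) //.
  have /commutative_semigroupsE mulC : commutative_semigroups S by [].
  exact: mulC.
have fN := theory_com N.
pose I u := forall v, theory N (wcat u v) u.
have fI : fi_ideal I.
  split=> [u v uv Iu w|w u Iu v|phi u Iu v].
  - apply: (fic_trans fN (v := wcat u w)).
      by apply: fic_perm => //; rewrite !letters_wcat perm_cat2r perm_sym.
    by apply: (fic_trans fN (Iu w)); exact: fic_perm.
  - rewrite -wcatA; apply: (fic_trans fN (Iu _)).
    by apply: (fic_sym fN); exact: Iu.
  - have [x xu] := fresh_letter u.
    pose psi y := if y == x then v else phi y.
    have := fic_subst fN psi (Iu (letter x)).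
    by rewrite wsubst_wcat (wsubst_fresh phi v xu) wsubst_letter /psi eqxx.
exists I => //.
have IZ w : Z w -> I w.
  move=> Zw v S NS phi; have [x xw] := fresh_letter w.
  rewrite NE in NS; have /NS wxw : ([set commutative_identity] `|`
      \bigcup_(w in Z) zero_identities w)%classic (wcat w (letter x), w).
    by right; exists w => //; exists x => //; left.
  have := wxw (fun y => if y == x then weval phi v else phi y).
  by rewrite /= !weval_wcat !(weval_fresh _ _ xw) /weval /= eqxx.
apply/funext => u; apply/funext => v; apply/propext; split=> [uv|]; last first.
  move=> [uv|[Iu Iv _]]; first exact: fic_perm.
  apply: (fic_trans fN (v := wcat u v)); first exact: (fic_sym fN).
  apply: (fic_trans fN (v := wcat v u)) => //.
  exact: fic_wcatC.
have fR := fic_restrict fI fic_full.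
(* The Rees quotient by [I] satisfies the defining identities of [N], so it belongs to [N]. *)
apply/(free_ofP fR); apply: uv; rewrite NE => e [->|[w Zw [x xw ew]]].
  by apply/(free_ofP fR); left; rewrite !letters_wcat perm_catC.
have Iw : I w by exact: IZ.
have Iwx : I (wcat w (letter x)) := fi_wcat fI _ Iw.
have Ixw : I (wcat (letter x) w).
  by apply: (fi_perm fI) Iwx; rewrite !letters_wcat perm_catC.
by case: ew => ->; apply/(free_ofP fR); right.
Qed.

(** * Sufficiency *)

(* Off by one: [wpow t n] is t^(n+1). *)
Definition wpow (t : word) (n : nat) : word := iter n (wcat t) t.

Lemma count_wpow (P : pred nat) (t : word) (n : nat) :
  count P (letters (wpow t n)) = n.+1 * count P (letters t).
Proof.
elim: n => [|n IHn]; first by rewrite mul1n.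
by rewrite [wpow _ _]/= letters_wcat count_cat -/(wpow t n) IHn -mulSn.
Qed.

Lemma mem_wpow (t : word) (n : nat) : letters (wpow t n) =i letters t.
Proof. by move=> x; rewrite -!has_pred1 !has_count count_wpow muln_gt0. Qed.

Lemma wpowM (t : word) (m n : nat) :
  perm_eq (letters (wpow (wpow t m) n)) (letters (wpow (wpow t n) m)).
Proof. by apply/permP => P; rewrite !count_wpow mulnCA. Qed.

(* Substitute [x t] for a letter [x] occurring on one side only.              *)
Lemma fic_content_change (T : wrel) (a w : word) :
  fi_congruence T -> T a w -> ~ same_content a w ->
  exists n, forall t, T a (wcat a (wpow t n)).
Proof.
move=> fT aw ncont.
have step u v x : T u v -> x \in letters v -> x \notin letters u ->
    exists n, forall t, T v (wcat v (wpow t n)).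
  move=> uv xv xu; exists (count_mem x (letters v)).-1 => t.
  apply: (fic_trans fT (fic_sym fT uv)).
  pose phi y := if y == x then wcat (letter x) t else letter y.
  have := fic_subst fT phi uv; rewrite (wsubst_fresh letter _ xu) wsubst_id.
  move=> uv'; apply: (fic_trans fT uv').
  apply: fic_perm => //; apply/permP => P.
  rewrite count_wsubst letters_wcat count_cat count_wpow prednK; last first.
    by rewrite -has_count has_pred1.
  elim: (letters v) => //= y s ->; rewrite /phi; case: eqP => [->|_] /=.
    by rewrite mulnDl mul1n; lia.
  by rewrite add0n addn0; lia.
have [x] : exists x, (x \in letters a) != (x \in letters w).
  apply: contrapT => /forallNP eq; apply: ncont => x.
  exact/eqP/negPn/negP/eq.
have [xa|xa] := boolP (x \in letters a);
  have [xw|xw] := boolP (x \in letters w) => // _.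
  exact: step (fic_sym fT aw) xa xw.
have [n wn] := step _ _ _ aw xw xa; exists n => t.
apply: (fic_trans fT aw); apply: (fic_trans fT (wn t)).
by apply: fic_wcat => //; exact: fic_sym.
Qed.

Lemma restrict_upper_modular (I : word -> Prop) (M : wrel) :
  fi_ideal I -> M = full_rel \/ M = same_content ->
  upper_modular (restrict I M).
Proof.
move=> fI ME S T fS fT SR.
have fM : fi_congruence M.
  by case: ME => ->; [exact: fic_full|exact: fic_content].
have cM : sub_wrel same_content M by case: ME => ->.
have fR := fic_restrict fI fM.
have fRT := fic_meet fR fT.
have fK := fic_joinP fS fRT.
set R := restrict I M in fR fRT fK *; set K := fic_join S _ in fK *.
pose absorbing u := exists n, forall t, {subset letters t <= letters u} ->
  K u (wcat u (wpow t n)).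
have half u v : I u -> I v -> M u v -> fic_join S T u v ->
    K u v \/ (M = same_content /\ absorbing u).
  move=> Iu Iv Muv uv.
  (* Invariant along the chain from [u]: the current word [w] is one [T]-step from a word [a] of the
     ideal already reached by [K]. An [S]-step inside [I] allows [a] to be replaced by its target,
     unless [T] has changed the content between [a] and [w]. *)
  pose inv w := (exists a, [/\ I a, M u a, K u a & T a w]) \/
    (M = same_content /\ absorbing u).
  suff [[a [Ia Mua Kua Tav]]|] : inv v; [left|by right|].
    apply: (fic_trans fK Kua); apply: fic_joinr; split=> //; right; split=> //.
    exact: fic_trans fM _ _ _ (fic_sym fM Mua) Muv.
  have : inv u by left; exists u; split=> //; exact: fic_refl.
  elim: {Iv Muv} uv => // [w w' ww'|b c d _ bc _ cd /bc/cd //].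
  case=> [[a [Ia Mua Kua Taw]]|]; last by right.
  case: ww' => [Sww'|Tww']; last first.
    by left; exists a; split=> //; exact: fic_trans fT _ _ _ Taw Tww'.
  case: (SR _ _ Sww') => [ww'|[Iw Iw' Mww']].
    left; exists a; split=> //.
    exact: fic_trans fT _ _ _ Taw (fic_perm fT ww').
  have [Maw|nMaw] := pselect (M a w).
    left; exists w'; split=> //; last exact: fic_refl.
      exact: fic_trans fM _ _ _ Mua (fic_trans fM Maw Mww').
    apply: (fic_trans fK Kua).
    apply: (fic_trans fK (v := w)); last exact: fic_joinl.
    by apply: fic_joinr; split=> //; right.
  case: ME => [MF|MC]; first by case: nMaw; rewrite MF.
  rewrite MC in nMaw; right; split=> //.
  have [n an] := fic_content_change fT Taw nMaw; exists n => t tu.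
  have Kan : K a (wcat a (wpow t n)).
    apply: fic_joinr; split=> //; right; split=> //; first exact: fi_wcat.
    rewrite MC in Mua *; move=> x; rewrite letters_wcat mem_cat mem_wpow -Mua.
    by have [/tu ->|_] := boolP (x \in letters t); rewrite ?orbT ?orbF.
  apply: (fic_trans fK Kua); apply: (fic_trans fK Kan).
  by apply: fic_wcat => //; exact: fic_sym.
move=> u v [uv _|[Iu Iv Muv] uv]; first exact: fic_perm.
have [//|[MC [n un]]] := half _ _ Iu Iv Muv uv.
have vu := fic_sym (fic_joinP fS fT) uv.
have [Kvu|[_ [m vm]]] := half _ _ Iv Iu (fic_sym fM Muv) vu.
  exact: fic_sym.
rewrite MC in Muv.
(* Up to order, [E] is a power with either exponent, so that both [u] and [v] absorb it. *)
pose E := wpow (wpow u n) m.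
have memE : letters E =i letters u by move=> x; rewrite !mem_wpow.
have IE : I E.
  have Ipow w k : I w -> I (wpow w k).
    by move=> Iw; case: k => // k; exact: fi_wcat.
  by apply: (Ipow); apply: (Ipow).
(* Letters outside the content of [u] are sent into it. Multiplied by [E], every image of a word of
   the chain lies in [I] and has the content of [u], so [T]-steps become steps of [R] as well. *)
pose phi y := letter (if y \in letters u then y else u.1).
have phiP w : {subset letters w <= letters u} ->
    perm_eq (letters (wsubst phi w)) (letters w).
  move=> wu; rewrite letters_wsubst.
  suff -> : [seq letters (phi x) | x <- letters w] =
      [seq [:: x] | x <- letters w].
    by rewrite flatten_seq1.
  by apply/eq_in_map => x /wu xu; rewrite /phi xu.
have map a b : fic_join S T a b ->
    K (wcat (wsubst phi a) E) (wcat (wsubst phi b) E).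
  elim=> [c d [cd|cd]|c|c d e _ cd _ de].
  - by apply: fic_joinl; apply: fic_wcat => //; exact: fic_subst.
  - apply: fic_joinr; split; last by apply: fic_wcat => //; exact: fic_subst.
    have IwE w : I (wcat w E).
      by apply: (fi_perm fI) (fi_wcat fI w IE); rewrite !letters_wcat perm_catC.
    right; split=> //; apply: cM => x; rewrite !letters_wcat !mem_cat memE.
    have [|xu] := boolP (x \in letters u); first by rewrite !orbT.
    suff out w : (x \in letters (wsubst phi w)) = false by rewrite !out.
    apply/negP => /mem_wsubst[y _].
    rewrite /phi /letters /= mem_seq1 => /eqP xE; move: xu; rewrite xE.
    by case: ifP => [->|_] //; rewrite mem_head.
  - exact: fic_refl.
  - exact: fic_trans fK _ _ _ cd de.
have absE : K u (wcat u E).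
  apply: (fic_trans fK (un (wpow u m) _)) => [x|]; first by rewrite mem_wpow.
  by apply: fic_perm => //; rewrite !letters_wcat perm_cat2l; exact: wpowM.
apply: (fic_trans fK absE).
apply: (fic_trans fK (v := wcat (wsubst phi u) E)).
  apply: fic_perm => //; rewrite !letters_wcat perm_cat2r perm_sym.
  exact: phiP.
apply: (fic_trans fK (map _ _ uv)); apply: (fic_sym fK).
apply: (fic_trans fK (vm (wpow u n) _)) => [x|].
  by rewrite mem_wpow Muv.
apply: fic_perm => //; rewrite !letters_wcat.
by apply: perm_cat; [rewrite perm_sym; apply: phiP => x; rewrite -Muv|].
Qed.

(** * Necessity *)

Definition long_word (r : nat) (u : word) : Prop := r < size (letters u).

Definition has_power (k : nat) (u : word) : Prop :=
  exists x, k <= count_mem x (letters u).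

Lemma size_wsubst (phi : nat -> word) (w : word) :
  size (letters w) <= size (letters (wsubst phi w)).
Proof.
rewrite -[leqRHS]count_predT count_wsubst.
elim: (letters w) => //= x s IHs; rewrite count_predT.
by case: (phi x) => y t /=; lia.
Qed.

Lemma fi_long (r : nat) : fi_ideal (long_word r).
Proof.
split=> [u v /perm_size uv|w u|phi u]; rewrite /long_word.
- by rewrite uv.
- by rewrite letters_wcat size_cat => /leq_trans; apply; exact: leq_addr.
- by move=> /leq_trans; apply; exact: size_wsubst.
Qed.

Lemma count_wsubst_le (P : pred nat) (phi : nat -> word) (x : nat) (w : word) :
  count_mem x (letters w) * count P (letters (phi x))
    <= count P (letters (wsubst phi w)).
Proof.
rewrite count_wsubst; elim: (letters w) => //= y s IHs.
by rewrite mulnDl leq_add //; case: eqP => [->|]; rewrite ?mul1n.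
Qed.

Lemma fi_power (k : nat) : fi_ideal (has_power k).
Proof.
split=> [u v /permP uv [x]|w u [x xu]|phi u [x xu]].
- by rewrite uv; exists x.
- by exists x; rewrite letters_wcat count_cat (leq_trans xu) ?leq_addr.
- exists (phi x).1; apply: leq_trans (leq_trans xu _) (count_wsubst_le _ _ x _).
  by rewrite leq_pmulr //= eqxx.
Qed.

Lemma fi_idealU (I J : word -> Prop) :
  fi_ideal I -> fi_ideal J -> fi_ideal (fun u => I u \/ J u).
Proof.
move=> [pI wI iI] [pJ wJ iJ]; split.
- by move=> u v uv [/(pI _ _ uv)|/(pJ _ _ uv)]; [left|right].
- by move=> w u [/(wI w)|/(wJ w)]; [left|right].
- by move=> phi u [/(iI phi)|/(iJ phi)]; [left|right].
Qed.

(** The first step of the chain that leaves the rearrangements of [u] may be taken to start at [u]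
    itself. *)
Lemma fic_join_neighbour (S T : wrel) (u v : word) :
  fi_congruence S -> fi_congruence T -> fic_join S T u v ->
  ~ perm_eq (letters u) (letters v) ->
  exists2 w, ~ perm_eq (letters u) (letters w) & S u w \/ T u w.
Proof.
move=> fS fT; elim=> [a b ab nab|a|a b c _ IHab _ IHbc nac].
- by exists b.
- by rewrite perm_refl.
- have [ab|/negP/IHab//] := boolP (perm_eq (letters a) (letters b)).
  have [|w nbw bw] := IHbc.
    by move=> bc; apply: nac; exact: perm_trans bc.
  exists w.
    by move=> aw; apply: nbw; apply: perm_trans aw; rewrite perm_sym.
  case: bw => bw; [left|right].
    exact: fic_trans fS _ _ _ (fic_perm fS ab) bw.
  exact: fic_trans fT _ _ _ (fic_perm fT ab) bw.
Qed.

(* Upper modularity is applied with [S] the restriction of [R] to [I]: the    *)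
(* class of [u] under [S] is trivial, so the detour through [I] must be       *)
(* replaced by a step which is both in [R] and in [T].                        *)
Lemma upper_modular_detour (R T : wrel) (I : word -> Prop) (u v u' v' : word) :
  upper_modular R -> fi_congruence R -> fi_congruence T -> fi_ideal I ->
  ~ I u -> ~ perm_eq (letters u) (letters v) -> R u v ->
  T u u' -> T v v' -> I u' -> I v' -> R u' v' ->
  exists w, [/\ ~ perm_eq (letters u) (letters w), R u w & T u w].
Proof.
move=> umR fR fT fI nIu nuv uv uu' vv' Iu' Iv' uv'.
have fS := fic_restrict fI fR.
have SR : sub_wrel (restrict I R) R by move=> a b [|[]//]; exact: fic_perm.
have STuv : fic_join (restrict I R) T u v.
  have fST := fic_joinP fS fT.
  apply: (fic_trans fST (v := u')); first exact: fic_joinr.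
  apply: (fic_trans fST (v := v')); last by apply: fic_joinr; exact: fic_sym.
  by apply: fic_joinl; right.
have := umR _ _ fS fT SR _ _ uv STuv.
case/(fic_join_neighbour fS (fic_meet fR fT)) => // w nuw.
case=> [[//|[Iu _ _]]|[uw Tuw]].
  by case: nIu.
by exists w.
Qed.

(** * Periodicity, and words related to high powers *)

Lemma fic_wpow (R : wrel) (u v : word) (n : nat) :
  fi_congruence R -> R u v -> R (wpow u n) (wpow v n).
Proof.
move=> fR uv; elim: n => //= n IHn.
apply: (fic_trans fR (fic_wcat fR _ uv)).
apply: (fic_trans fR (v := wcat (wpow u n) v)).
  exact: fic_wcatC.
apply: (fic_trans fR (fic_wcat fR v IHn)).
exact: fic_wcatC.
Qed.

Lemma split_power (x n : nat) (s : seq nat) :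
  n <= count_mem x s -> exists s', perm_eq s (nseq n x ++ s').
Proof.
elim: n s => [|n IHn] s xs; first by exists s.
have sx : x \in s by rewrite -has_pred1 has_count; exact: leq_trans xs.
have remx := perm_to_rem sx.
have [|s' rems'] := IHn (rem x s).
  by move/permP/(_ (pred1 x)): remx => /= remx; rewrite remx eqxx in xs.
by exists s'; apply: (perm_trans remx); rewrite /= perm_cons.
Qed.

(** If the lengths differ, identifying all letters gives an identity between two distinct powers of
    [x]. The period is [d.+1], since [wpow] is off by one. *)
Lemma fic_periodic (R : wrel) (u v : word) :
  fi_congruence R -> R u v -> ~ perm_eq (letters u) (letters v) ->
  exists p d, forall w x, p <= count_mem x (letters w) ->
    R w (wcat w (wpow (letter x) d)).
Proof.
move=> fR.
have unequal_size a b : R a b -> size (letters a) < size (letters b) ->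
    exists p d, forall w x, p <= count_mem x (letters w) ->
      R w (wcat w (wpow (letter x) d)).
  move=> ab szab.
  exists (size (letters a)), (size (letters b) - size (letters a)).-1 => w x.
  move=> /split_power[s ws].
  have powE c : perm_eq (letters (wsubst (fun=> letter x) c))
      (nseq (size (letters c)) x).
    by rewrite letters_wsubst; elim: (letters c) => //= y t; rewrite perm_cons.
  apply: (fic_ext (s := s) fR (fic_subst fR (fun=> letter x) ab)).
    by apply: (perm_trans ws); rewrite perm_cat2r perm_sym.
  apply/permP => P; move/permP/(_ P): ws => ws.
  move/permP/(_ P): (powE b) => bE.
  rewrite letters_wcat !count_cat ws count_cat bE count_wpow !count_nseq /=.
  by rewrite /= in szab; case: (P x); lia.
have unequal_sizes a b : R a b -> size (letters a) != size (letters b) ->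
    exists p d, forall w x, p <= count_mem x (letters w) ->
      R w (wcat w (wpow (letter x) d)).
  rewrite neq_ltn => ab /orP[]; first exact: unequal_size.
  by apply: unequal_size; exact: fic_sym.
move=> uv nuv.
have [sz|] := eqVneq (size (letters u)) (size (letters v)); last first.
  exact: unequal_sizes uv.
have [x xuv] : exists x, count_mem x (letters u) != count_mem x (letters v).
  apply: contrapT => /forallNP eq; apply: nuv; apply/allP => x _.
  by apply/negPn/negP; exact: eq.
(* Doubling a letter with different numbers of occurrences makes the lengths differ. *)
pose phi y := if y == x then wcat (letter x) (letter x) else letter y.
apply: (unequal_sizes _ _ (fic_subst fR phi uv)).
have szE w : size (letters (wsubst phi w)) =
    size (letters w) + count_mem x (letters w).
  rewrite -[LHS]count_predT count_wsubst.
  elim: (letters w) => //= y s ->; rewrite /phi; case: eqP => _ /=; lia.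
by rewrite !szE sz eqn_add2l.
Qed.

(** For positive [e], the theory of the join of [SL] with the abelian groups of exponent dividing
    [e]. *)
Definition mod_content (e : nat) : wrel := fun u v =>
  same_content u v /\
  forall x, count_mem x (letters u) = count_mem x (letters v) %[mod e].

Lemma count_wsubst_undup (P : pred nat) (phi : nat -> word) (w : word) :
  count P (letters (wsubst phi w)) =
  \sum_(x <- undup (letters w))
    count_mem x (letters w) * count P (letters (phi x)).
Proof.
rewrite count_wsubst sumnE big_map -big_undup_iterop_count.
apply: eq_bigr => x _; rewrite Monoid.iteropE.
by rewrite iter_addn_0 mulnC.
Qed.

Lemma fic_mod_content (e : nat) : fi_congruence (mod_content e).
Proof.
have fC := fic_content; split.
- move=> u v uv; split; first exact: (fic_perm fC).
  by move=> x; rewrite (permP uv).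
- by move=> u v [uv cuv]; split=> [|x]; [exact: (fic_sym fC)|rewrite cuv].
- move=> v u w [uv cuv] [vw cvw]; split=> [|x]; last by rewrite cuv cvw.
  exact: fic_trans fC _ _ _ uv vw.
- move=> w u v [uv cuv]; split=> [|x]; first exact: (fic_wcat fC).
  by rewrite !letters_wcat !count_cat -modnDml cuv modnDml.
- move=> phi u v [uv cuv]; split=> [|x]; first exact: (fic_subst fC).
  have undupE : perm_eq (undup (letters u)) (undup (letters v)).
    by rewrite uniq_perm ?undup_uniq // => y; rewrite !mem_undup uv.
  rewrite !count_wsubst_undup (perm_big _ undupE).
  rewrite -[LHS]modn_summ -[RHS]modn_summ.
  by congr (_ %% e); apply: eq_bigr => y _; rewrite -modnMml cuv modnMml.
Qed.

(** The detour goes through the powers [e + 1] of [u] and [v], which [mod_content e] does not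
    distinguish from [u] and [v]. Words in which every letter occurs fewer than [e] times are
    related by it only if they are rearrangements of each other. *)
Lemma upper_modular_power (R : wrel) (e : nat) (u v : word) :
  0 < e -> upper_modular R -> fi_congruence R -> R u v ->
  ~ perm_eq (letters u) (letters v) -> exists2 w, R u w & has_power e w.
Proof.
move=> e0 umR fR uv nuv.
have [|nu] := pselect (has_power e u); first by exists u => //; exact: fic_refl.
have powI w : has_power e (wpow w e).
  by exists w.1; rewrite count_wpow /= eqxx; nia.
have powT w : mod_content e w (wpow w e).
  split=> x; first by rewrite mem_wpow.
  by rewrite count_wpow mulSn addnC mulnC modnMDl.
have [w [nuw uw [cuw muw]]] := upper_modular_detour umR fR (fic_mod_content e)
  (fi_power e) nu nuv uv (powT u) (powT v) (powI u) (powI v) (fic_wpow e fR uv).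
exists w => //; apply: contrapT => nw; apply: nuw; apply/allP => x _; apply/eqP.
have small a : ~ has_power e a -> count_mem x (letters a) < e.
  by move=> na; rewrite ltnNge; apply/negP => xa; apply: na; exists x.
by have := muw x; rewrite !modn_small ?small.
Qed.

(** * Identities in two letters, and absorption *)

Definition two_letters (r x y : nat) (u : word) : Prop :=
  x != y /\
  exists2 k, 0 < k < 3 & perm_eq (letters u) (nseq (r - k) x ++ nseq k y).

Definition two_letters_rel (r : nat) : wrel := fun u v =>
  [\/ perm_eq (letters u) (letters v), long_word r u /\ long_word r v |
      exists x y, two_letters r x y u /\ two_letters r x y v].

Lemma count_two_letters (P : pred nat) (u : word) (m n x y : nat) :
  perm_eq (letters u) (nseq m x ++ nseq n y) ->
  count P (letters u) = m * P x + n * P y.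
Proof. by move/permP->; rewrite count_cat !count_nseq ![P _ * _]mulnC. Qed.

Lemma two_letters_size (r x y : nat) (u : word) :
  5 <= r -> two_letters r x y u -> size (letters u) = r.
Proof.
move=> r5 [_ [k k3 /perm_size ->]]; rewrite size_cat !size_nseq; lia.
Qed.

(** With [5 <= r], the letter [x] occurs at least three times and [y] at most twice, so their roles
    cannot be exchanged. *)
Lemma two_letters_inj (r x y x' y' : nat) (u : word) :
  5 <= r -> two_letters r x y u -> two_letters r x' y' u -> x = x' /\ y = y'.
Proof.
move=> r5 [xy [k k3 uk]] [xy' [k' k3' uk']].
have eqc z := etrans (esym (count_two_letters (pred1 z) uk))
  (count_two_letters (pred1 z) uk').
have := eqc x; have := eqc y; rewrite /= !eqxx.
rewrite [y == x]eq_sym [y' == x]eq_sym [x' == x]eq_sym.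
rewrite [x' == y]eq_sym [y' == y]eq_sym.
rewrite (negPf xy).
have [xx'|xx'] := eqVneq x x'; have [yy'|yy'] := eqVneq y y';
  have [xy1|_] := eqVneq x y'; have [yx1|_] := eqVneq y x'; lia.
Qed.

Lemma two_letters_perm (r x y : nat) (u v : word) :
  perm_eq (letters u) (letters v) -> two_letters r x y u -> two_letters r x y v.
Proof.
move=> uv [xy [k k3 uk]]; split=> //; exists k => //.
by apply: perm_trans uk; rewrite perm_sym.
Qed.

Lemma count_wsubst_two_letters (P : pred nat) (phi : nat -> word) (u : word)
    (m n x y : nat) :
  perm_eq (letters u) (nseq m x ++ nseq n y) ->
  count P (letters (wsubst phi u)) =
  m * count P (letters (phi x)) + n * count P (letters (phi y)).
Proof.
move=> uE; rewrite count_wsubst (perm_sumn (perm_map _ uE)).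
by rewrite map_cat !map_nseq sumn_cat !sumn_nseq ![count _ _ * _]mulnC.
Qed.

(** For substitutions: if [x] and [y] go to distinct letters, a pair of the same form results; if
    they go to one letter, the images coincide; a longer image makes both words longer than [r]. *)
Lemma fic_two_letters (r : nat) : 5 <= r -> fi_congruence (two_letters_rel r).
Proof.
move=> r5.
have tl_perm := two_letters_perm.
have long_perm u v : perm_eq (letters u) (letters v) ->
    long_word r u -> long_word r v.
  exact: fi_perm (fi_long r) _ _.
have tl_long x y u : two_letters r x y u -> ~ long_word r u.
  by move=> /(two_letters_size r5); rewrite /long_word => ->; rewrite ltnn.
split.
- by move=> u v uv; constructor 1.
- move=> u v [uv|[? ?]|[x [y [? ?]]]].
  + by constructor 1; rewrite perm_sym.
  + by constructor 2.
  + by constructor 3; exists x, y.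
- move=> v u w [uv|[lu lv]|[x [y [xu xv]]]] [vw|[lv' lw]|[x' [y' [xv' xw]]]].
  + by constructor 1; exact: perm_trans vw.
  + constructor 2; split=> //; apply: long_perm lv'; by rewrite perm_sym.
  + constructor 3; exists x', y'; split=> //.
    by apply: tl_perm xv'; rewrite perm_sym.
  + constructor 2; split=> //; exact: long_perm lv.
  + by constructor 2.
  + by have := tl_long _ _ _ xv'.
  + constructor 3; exists x, y; split=> //; exact: tl_perm xv.
  + by have := tl_long _ _ _ xv.
  + have [xx' yy'] := two_letters_inj r5 xv xv'; rewrite -xx' -yy' in xw.
    by constructor 3; exists x, y.
- move=> w u v [uv|[lu lv]|[x [y [xu xv]]]].
  + by constructor 1; rewrite !letters_wcat perm_cat2r.
  + by constructor 2; split; apply: fi_wcat (fi_long r) _ _ _.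
  + constructor 2; rewrite /long_word !letters_wcat !size_cat.
    by rewrite (two_letters_size r5 xu) (two_letters_size r5 xv) /=; lia.
- move=> phi u v [uv|[lu lv]|[x [y [xu xv]]]].
  + by constructor 1; exact: perm_wsubst.
  + by constructor 2; split; apply: fi_subst (fi_long r) _ _ _.
  + have [xy [k k3 uk]] := xu; have [_ [l l3 vl]] := xv.
    have [[x' xE] | xl] : (exists x', phi x = letter x') \/
        1 < size (letters (phi x)).
      by case: (phi x) => a [|b s]; [left; exists a|right].
    have [[y' yE] | yl] : (exists y', phi y = letter y') \/
        1 < size (letters (phi y)).
      by case: (phi y) => a [|b s]; [left; exists a|right].
    * have phiE w j : perm_eq (letters w) (nseq (r - j) x ++ nseq j y) ->
          perm_eq (letters (wsubst phi w)) (nseq (r - j) x' ++ nseq j y').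
        move=> wj; apply/permP => P.
        rewrite (count_wsubst_two_letters P phi wj) xE yE count_cat.
        by rewrite !count_nseq /= !addn0 ![P _ * _]mulnC.
      have [x'y'|x'y'] := eqVneq x' y'; last first.
        constructor 3; exists x', y'; split; split=> //.
          by exists k => //; exact: phiE.
        by exists l => //; exact: phiE.
      constructor 1; apply: (perm_trans (phiE _ _ uk)).
      rewrite perm_sym; apply: (perm_trans (phiE _ _ vl)).
      apply/permP => P; rewrite !count_cat !count_nseq x'y'.
      by case: (P y') => /=; lia.
    * constructor 2; rewrite /long_word -!(count_predT (letters (wsubst _ _))).
      rewrite (count_wsubst_two_letters _ _ uk).
      rewrite (count_wsubst_two_letters _ _ vl).
      have x1 : 0 < size (letters (phi x)) by [].
      by rewrite !count_predT; split; nia.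
    * constructor 2; rewrite /long_word -!(count_predT (letters (wsubst _ _))).
      rewrite (count_wsubst_two_letters _ _ uk).
      rewrite (count_wsubst_two_letters _ _ vl).
      have y1 : 0 < size (letters (phi y)) by [].
      by rewrite !count_predT; split; nia.
Qed.

Definition absorbs (R : wrel) (e : nat) : Prop := forall u x y,
  e <= count_mem x (letters u) -> y \in letters u -> R u (wcat u (letter y)).

Lemma upper_modular_absorbs (R : wrel) (u v : word) :
  upper_modular R -> fi_congruence R -> R u v ->
  ~ perm_eq (letters u) (letters v) ->
  exists2 e, 0 < e & absorbs R e.
Proof.
move=> umR fR uv nuv; have [p [d perR]] := fic_periodic fR uv nuv.
pose r := p + 5.
pose a : word := (0, nseq (p + 2) 0 ++ [:: 1; 1]).
pose b : word := (0, nseq (p + 3) 0 ++ [:: 1]).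
have aE : perm_eq (letters a) (nseq (r - 2) 0 ++ nseq 2 1).
  by rewrite (_ : r - 2 = (p + 2).+1) //; rewrite /r; lia.
have bE : perm_eq (letters b) (nseq (r - 1) 0 ++ nseq 1 1).
  by rewrite (_ : r - 1 = (p + 3).+1) //; rewrite /r; lia.
have r5 : 5 <= r by exact: leq_addl.
(* This ideal contains [b] and all long words but not [a], where no letter occurs more than [r - 2]
   times. *)
pose I u := long_word r u \/ has_power (r - 1) u.
have fI : fi_ideal I := fi_idealU (fi_long r) (fi_power (r - 1)).
have longw w x : size (letters w) = r ->
    long_word r (wcat w (wpow (letter x) d)).
  move=> sz; rewrite /long_word letters_wcat size_cat sz.
  by rewrite -[X in _ + X]count_predT count_wpow /=; lia.
have ta : two_letters r 0 1 a by split=> //; exists 2.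
have tb : two_letters r 0 1 b by split=> //; exists 1.
have [sa sb] := (two_letters_size r5 ta, two_letters_size r5 tb).
have ab : R a b.
  have [||||||||w [naw aw Taw]] := @upper_modular_detour R (two_letters_rel r) I
      a (wcat a (wpow (letter 0) d)) b (wcat b (wpow (letter 0) d)) umR fR
      (fic_two_letters r5) fI.
  - case=> [|[z]]; first by rewrite /long_word sa ltnn.
    rewrite (count_two_letters _ aE) /r /=; case: z => [|[|z]] /=; lia.
  - move=> /perm_size; rewrite letters_wcat size_cat => /eqP.
    rewrite -[X in X == _]addn0 eqn_add2l -[X in _ == X]count_predT.
    by rewrite count_wpow.
  - by apply: perR; rewrite (count_two_letters _ aE) /r /=; lia.
  - by constructor 3; exists 0, 1.
  - by constructor 2; split; exact: longw.
  - by right; exists 0; rewrite (count_two_letters _ bE) /r /=; lia.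
  - by left; exact: longw.
  - by apply: perR; rewrite (count_two_letters _ bE) /r /=; lia.
  (* Up to order, the class of [a] under [T] is just [a] and [b], so [w] must be [b]. *)
  have [x [y [xa xw]]] : exists x y, two_letters r x y a /\ two_letters r x y w.
    by case: Taw => // -[]; rewrite /long_word sa ltnn.
  have [x0 y1] := two_letters_inj r5 xa ta; rewrite {}x0 {}y1 in xw.
  case: xw => _ [k k3 wk]; have [k2|k1] := eqVneq k 2.
    by case: naw; apply: (perm_trans aE); rewrite perm_sym -k2.
  apply: (fic_trans fR aw); apply: fic_perm => //; apply: (perm_trans wk).
  by rewrite perm_sym (_ : k = 1) //; lia.
(* Sending [0] to [x] and [1] to [x^2] turns [a] into [x^(p+7)] and [b] into [x^(p+6)]. *)
pose e := p + 6.
have absx w x : e <= count_mem x (letters w) -> R w (wcat w (letter x)).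
  move=> /split_power[s ws].
  pose phi y := if y == 1 then wcat (letter x) (letter x) else letter x.
  apply: (fic_sym fR); apply: (fic_ext (s := s) fR (fic_subst fR phi ab)).
    apply/permP => P; rewrite letters_wcat !count_cat (permP ws) count_cat.
    rewrite (count_wsubst_two_letters _ _ aE) /= count_nseq /r /e.
    by case: (P x) => /=; lia.
  apply/permP => P; rewrite !count_cat (permP ws) count_cat.
  rewrite (count_wsubst_two_letters _ _ bE) /= count_nseq /r /e.
  by case: (P x) => /=; lia.
exists e; first by rewrite /e; lia.
move=> w x y xw yw; have [<-|yx] := eqVneq x y; first exact: absx.
have [s ws] := split_power xw.
have ys : y \in s.
  move: yw; rewrite (perm_mem ws) mem_cat mem_nseq [y == x]eq_sym.
  by rewrite (negPf yx) andbF.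
have ps := perm_to_rem ys.
apply: (fic_sym fR); apply: (fic_trans fR (v := wcat w (letter x))); last first.
  by apply: (fic_sym fR); exact: absx.
(* The identity [x^(p+3) y^2 = x^(p+4) y] trades the additional [y] for an [x]; the three other
   copies of [x] stay in the context. *)
pose phi z := letter (if z == 1 then y else x).
apply: (fic_ext (s := nseq 3 x ++ rem y s) fR (fic_subst fR phi ab));
  apply/permP => P;
  rewrite letters_wcat !count_cat (permP ws) count_cat (permP ps).
  rewrite (count_wsubst_two_letters _ _ aE) /= !count_nseq /r /e.
  by case: (P x); case: (P y) => /=; lia.
rewrite (count_wsubst_two_letters _ _ bE) /= !count_nseq /r /e.
by case: (P x); case: (P y) => /=; lia.
Qed.

(** * The shape of upper modular theories, and the theorem *)

Lemma upper_modular_restrict (R : wrel) :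
  upper_modular R -> fi_congruence R ->
  exists2 I, fi_ideal I &
    R = restrict I full_rel \/ R = restrict I same_content.
Proof.
move=> umR fR.
have [permR|] := pselect (forall u v, R u v -> perm_eq (letters u) (letters v)).
  exists (fun=> False) => //; left.
  apply/funext => u; apply/funext => v; apply/propext; split=> [/permR|[|[]//]].
    by left.
  exact: fic_perm.
move=> /existsNP[a0 /existsNP[b0 /not_implyP[ab0 nab0]]].
have [e e0 absR] := upper_modular_absorbs umR fR ab0 nab0.
pose I u := exists2 w, R u w & has_power e w.
have fI : fi_ideal I.
  have fP := fi_power e; split.
  - move=> u v uv [w uw ew]; exists w => //.
    by apply: (fic_trans fR _ uw); apply: fic_perm; rewrite // perm_sym.
  - move=> w u [w' uw' ew'].
    by exists (wcat w' w); [exact: fic_wcat|exact: fi_wcat].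
  - move=> phi u [w uw ew].
    by exists (wsubst phi w); [exact: fic_subst|exact: fi_subst].
have RI u v : R u v -> ~ perm_eq (letters u) (letters v) -> I u /\ I v.
  move=> uv nuv; split; first exact: upper_modular_power uv nuv.
  apply: (upper_modular_power e0 umR fR (fic_sym fR uv)).
  by rewrite perm_sym.
have absI u y : I u -> y \in letters u -> R u (wcat u (letter y)).
  move=> [w uw [x xw]] yu.
  have wx : R w (wcat w (letter x)).
    apply: (absR _ x) => //.
    by rewrite -has_pred1 has_count; exact: leq_trans xw.
  have ux : R u (wcat u (letter x)).
    apply: (fic_trans fR uw); apply: (fic_trans fR wx).
    by apply: fic_wcat => //; exact: fic_sym.
  (* The letter [y] need not occur in [w], so the high power of [x] is first brought next to [u],
     which does contain [y]. *)
  have upow : R u (wcat u (wpow (letter x) e)).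
    by apply: fic_absorb => // z; rewrite mem_wpow mem_seq1 => /eqP ->.
  apply: (fic_trans fR upow).
  apply: (fic_trans fR (v := wcat (wcat u (wpow (letter x) e)) (letter y))).
    apply: (absR _ x).
      by rewrite letters_wcat count_cat count_wpow /= eqxx; lia.
    by rewrite letters_wcat mem_cat yu.
  by apply: fic_wcat => //; exact: fic_sym.
exists I => //.
have [contR|] := pselect (forall u v, R u v -> same_content u v).
  right; apply/funext => u; apply/funext => v; apply/propext; split=> [uv|].
    have [|/negP/(RI _ _ uv)[Iu Iv]] := boolP (perm_eq (letters u) (letters v)).
      by left.
    by right; split=> //; exact: contR.
  case=> [|[Iu Iv uv]]; first exact: fic_perm.
  apply: (fic_trans fR (v := wcat u v)).
    by apply: fic_absorb => // y; rewrite -uv; exact: absI.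
  apply: (fic_trans fR (fic_wcatC _ _ fR)); apply: (fic_sym fR).
  by apply: fic_absorb => // y; rewrite uv; exact: absI.
move=> /existsNP[a /existsNP[b /not_implyP[ab nab]]]; left.
have [c [d [cd [z zd zc]]]] : exists c d, R c d /\
    exists2 z, z \in letters d & z \notin letters c.
  apply: contrapT => none; apply: nab => z.
  apply/idP/idP => zI; apply/negPn/negP => nz.
    by apply: none; exists b, a; split; [exact: fic_sym|exists z].
  by apply: none; exists a, b; split=> //; exists z.
have absP u y : has_power e u -> R u (wcat u (letter y)).
  move=> [x xu].
  have xinu : x \in letters u.
    by rewrite -has_pred1 has_count; exact: leq_trans xu.
  (* This turns [c] into a power of [x], absorbed by [u], and [d] into a word containing [y]. Hence
     [u] is related to a word with both [x^e] and [y], which absorbs [y]. *)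
  pose phi t := if t == z then letter y else letter x.
  have phic t : t \in letters (wsubst phi c) -> t \in letters u.
    rewrite (wsubst_fresh (fun=> letter x) _ zc) => /mem_wsubst[_ _].
    by rewrite mem_seq1 => /eqP ->.
  have phid : y \in letters (wsubst phi d).
    by apply/mem_wsubst; exists z; rewrite // /phi eqxx mem_head.
  have cdphi : R (wcat u (wsubst phi c)) (wcat u (wsubst phi d)).
    apply: (fic_trans fR (fic_wcatC _ _ fR)).
    apply: (fic_trans fR _ (fic_wcatC _ _ fR)).
    by apply: fic_wcat => //; exact: fic_subst.
  have uc : R u (wcat u (wsubst phi c)).
    by apply: fic_absorb => // t /phic; exact: absR xu.
  have ud := fic_trans fR uc cdphi.
  apply: (fic_trans fR ud).
  apply: (fic_trans fR (v := wcat (wcat u (wsubst phi d)) (letter y))).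
    apply: (absR _ x); rewrite letters_wcat.
      by rewrite count_cat (leq_trans xu) ?leq_addr.
    by rewrite mem_cat phid orbT.
  by apply: fic_wcat => //; exact: fic_sym.
have abs u v : I u -> R u (wcat u v).
  move=> [w uw ew]; apply: fic_absorb => // y _.
  apply: (fic_trans fR uw); apply: (fic_trans fR (absP _ y ew)).
  by apply: fic_wcat => //; exact: fic_sym.
apply/funext => u; apply/funext => v; apply/propext; split=> [uv|].
  have [|/negP/(RI _ _ uv)[Iu Iv]] := boolP (perm_eq (letters u) (letters v)).
    by left.
  by right.
case=> [|[Iu Iv _]]; first exact: fic_perm.
apply: (fic_trans fR (abs u v Iu)); apply: (fic_trans fR (fic_wcatC _ _ fR)).
by apply: (fic_sym fR); exact: abs.
Qed.

Theorem theorem1p6 (V : com_variety) :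
  lower_modular V <->
  V = COM \/
  exists M N : com_variety,
    (M = TRIV \/ M = SL) /\ zero_reduced N /\ V = Order.join M N.
Proof.
rewrite lower_modularP; split=> [umV|VE].
  have [I fI VI] := upper_modular_restrict umV (theory_com V).
  have fN := fic_restrict fI fic_full.
  (* For [COM] this gives [TRIV] joined with the 0-reduced variety of the empty ideal. *)
  right; suff [M ME VM] : exists2 M, M = TRIV \/ M = SL &
      theory V = rel_meet (theory M) (restrict I full_rel).
    exists M, (com_of fN); split=> //; split.
      by apply/zero_reducedP; exists I => //; exact: theory_com_of.
    by apply: theory_inj; rewrite theory_join theory_com_of.
  case: VI => ->; [exists TRIV|exists SL]; rewrite ?theory_TRIV ?theory_SL;
    try by [left|right].
    by apply/funext => u; apply/funext => v; apply/propext; split=> [|[]].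
  apply/funext => u; apply/funext => v; apply/propext.
  split=> [[uv|[Iu Iv uv]]|[uv [puv|[Iu Iv _]]]].
  - by split; [exact: (fic_perm fic_content)|left].
  - by split=> //; right.
  - by left.
  - by right.
suff [I fI VI] : exists2 I, fi_ideal I &
    theory V = restrict I full_rel \/ theory V = restrict I same_content.
  by case: VI => ->; apply: restrict_upper_modular; rewrite //; [left|right].
case: VE => [->|[M [N [ME [/zero_reducedP[I fI NI] ->]]]]].
  exists (fun=> False) => //; left.
  have fP : fi_congruence (restrict (fun=> False) full_rel).
    exact: fic_restrict.
  suff -> : COM = com_of fP by exact: theory_com_of.
  apply/eqP; rewrite eq_le; apply/andP; split.
    apply/theory_le; rewrite theory_com_of => u v [|[]//].
    exact: (fic_perm (theory_com COM)).
  by apply/com_leE => S; exact: com_variety_commutative.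
exists I => //; rewrite theory_join NI.
case: ME => ->; rewrite ?theory_TRIV ?theory_SL; [left|right].
  by apply/funext => u; apply/funext => v; apply/propext; split=> [[]|].
apply/funext => u; apply/funext => v; apply/propext.
split=> [[uv [puv|[Iu Iv _]]]|[uv|[Iu Iv uv]]].
- by left.
- by right.
- by split; [exact: (fic_perm fic_content)|left].
- by split=> //; right.
Qed.
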